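(* Up to equivalence, the positive root system of type $F(4)$ has only one splint $(\Delta_1,\Delta_2)$, namely the one of type $(A_1+B_3,\,8A(0,0))$, where $\Delta_1$ is the set of all even positive roots and $\Delta_2$ is the set of all odd positive roots.
   Context: The positive root system of the Lie superalgebra $F(4)$ (rank 4) has even roots $\delta$, $\varepsilon_i\pm\varepsilon_j$ ($1\le i<j\le3$), $\varepsilon_i$ ($1\le i\le 3$) and odd roots $\frac12(\delta\pm\varepsilon_1\pm\varepsilon_2\pm\varepsilon_3)$; these are positive with respect to the distinguished simple system $\alpha_1=\frac12(\delta-\varepsilon_1-\varepsilon_2-\varepsilon_3)$, $\alpha_2=\varepsilon_3$, $\alpha_3=\varepsilon_2-\varepsilon_3$, $\alpha_4=\varepsilon_1-\varepsilon_2$. $A(0,0)$ is the root system consisting of a single odd (positive) root; $A_r,B_r$ are the usual positive root systems of simple Lie algebras (all roots even). $X+Y$ denotes the (orthogonal, disjoint) sum and $kX$ the sum of $k$ copies of $X$. Embedding: for positive root systems $\Delta,\Delta'$ with even/odd parts $\Delta_{\bar0},\Delta_{\bar1}$ and $\Delta'_{\bar0},\Delta'_{\bar1}$, an embedding $\iota:\Delta\hookrightarrow\Delta'$ is an injective map with $\iota(\gamma)=\iota(\alpha)+\iota(\beta)$ for all $\alpha,\beta,\gamma\in\Delta$ with $\gamma=\alpha+\beta$, and $\iota(\Delta_{\bar0})\subseteq\Delta'_{\bar0}$, $\iota(\Delta_{\bar1})\subseteq\Delta'_{\bar1}$. Splint: $\Delta$ splinters as $(\Delta_1,\Delta_2)$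 if there are embeddings $\iota_1:\Delta_1\hookrightarrow\Delta$, $\iota_2:\Delta_2\hookrightarrow\Delta$ such that $\Delta$ is the disjoint union of their images and neither the rank of $\Delta_1$ nor the rank of $\Delta_2$ exceeds the rank of $\Delta$. In computing the ranks of $\Delta_1,\Delta_2$, components of type $A(0,0)$ are not counted. In the claim $\Delta_1,\Delta_2$ are identified with their images. Equivalence: let $W$ be the Weyl group generated by reflections in even roots only. Splints $(\Delta_1,\Delta_2)$ and $(\Delta_1',\Delta_2')$ of $\Delta$ are equivalent if there is $\sigma\in W$ carrying the even part of $\Delta_i\cup(-\Delta_i)$ onto the even part of $\Delta_i'\cup(-\Delta_i')$ for $i=1,2$, and similarly for the odd parts.
   Formalization: Both parts are nonempty, no part mixes A(0,0) with other components (else (A_1+B_3+A(0,0), 7A(0,0)) is a second splint), components carry their distinguished positive systems (else (D(2,2), 4A_1) is one), and splints are taken up to swapping the two parts. *)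

(* Defs.v *)
From HB Require Import structures.
From mathcomp Require Import all_boot all_order all_algebra.

Set Implicit Arguments.
Unset Strict Implicit.
Unset Printing Implicit Defensive.

Import Order.TTheory GRing.Theory Num.Theory.
Local Open Scope ring_scope.

(* A root system with a fixed positive part, given by its even and its odd
   positive roots in a rational coordinate space. *)
Record root_sys := RootSys {
  rdim : nat;
  even_roots : seq 'rV[rat]_rdim;
  odd_roots : seq 'rV[rat]_rdim
}.

Definition pos_roots (D : root_sys) := even_roots D ++ odd_roots D.

Section Families.
Variables (n : nat).
Implicit Types (k l : nat).

Definition eps (i : 'I_n) : 'rV[rat]_n := delta_mx 0 i.

Definition multiples k (c : rat) (u : 'I_k -> 'rV[rat]_n) :=
  [seq c *: u i | i <- enum 'I_k].

Definition diffs k (u : 'I_k -> 'rV[rat]_n) :=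
  [seq u p.1 - u p.2 | p : 'I_k * 'I_k <- enum {: 'I_k * 'I_k} & (p.1 < p.2)%N].

Definition sums k (u : 'I_k -> 'rV[rat]_n) :=
  [seq u p.1 + u p.2 | p : 'I_k * 'I_k <- enum {: 'I_k * 'I_k} & (p.1 < p.2)%N].

Definition cross_diffs k l (u : 'I_k -> 'rV[rat]_n) (v : 'I_l -> 'rV[rat]_n) :=
  [seq u p.1 - v p.2 | p : 'I_k * 'I_l <- enum {: 'I_k * 'I_l}].

Definition cross_sums k l (u : 'I_k -> 'rV[rat]_n) (v : 'I_l -> 'rV[rat]_n) :=
  [seq u p.1 + v p.2 | p : 'I_k * 'I_l <- enum {: 'I_k * 'I_l}].

(* b i = true stands for a minus sign in front of the i-th coordinate. *)
Definition half_spin (b : {ffun 'I_n -> bool}) : 'rV[rat]_n :=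
  2%:R^-1 *: \sum_(i < n) (-1) ^+ b i *: eps i.

Definition half_spins (P : pred {ffun 'I_n -> bool}) :=
  [seq half_spin b | b <- enum {ffun 'I_n -> bool} & P b].

Definition even_signs (b : {ffun 'I_n -> bool}) := ~~ odd (\sum_(i < n) b i)%N.

End Families.

(* Connected types. The purely even ones come first; [sA m n], ..., [sG3] are
   A(m,n) = sl(m+1|n+1), B(m,n) = osp(2m+1|2n), C(n) = osp(2|2n-2),
   D(m,n) = osp(2m|2n), D(2,1;a), F(4) and G(3). The parameter a of D(2,1;a)
   changes only the bilinear form, not the roots, so it is omitted. *)
Inductive component :=
  | cA of nat | cB of nat | cC of nat | cD of nat
  | cE6 | cE7 | cE8 | cF4 | cG2
  | sA of nat & nat | sB of nat & nat | sC of nat | sD of nat & nat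
  | sD21 | sF4 | sG3.

(* Ranges for which the type is a genuine connected root system. C(2) is left
   out because it is A(1,0). *)
Definition wf_component (c : component) : bool :=
  match c with
  | cA r => (1 <= r)%N
  | cB r => (2 <= r)%N
  | cC r => (3 <= r)%N
  | cD r => (4 <= r)%N
  | sB _ n => (1 <= n)%N
  | sC n => (3 <= n)%N
  | sD m n => (2 <= m)%N && (1 <= n)%N
  | _ => true
  end.

Definition is_A00 (c : component) : bool :=
  if c is sA 0 0 then true else false.

Definition rank (c : component) : nat :=
  match c with
  | cA r | cB r | cC r | cD r => r
  | cE6 => 6 | cE7 => 7 | cE8 => 8 | cF4 => 4 | cG2 => 2
  | sA m n => (m + n).+1
  | sB m n => m + n
  | sC n => n
  | sD m n => m + n
  | sD21 => 3 | sF4 => 4 | sG3 => 3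
  end%N.

(* Positive roots with respect to the (distinguished, in the super case)
   simple systems, in the usual coordinates of Bourbaki and of Kac. In the
   super types with two families of coordinates, the eps_i come before the
   delta_j, except for C(n), D(2,1;a), F(4) and G(3), where coordinate 0 is the
   special one. In G2 and G(3), eps_3 = - eps_1 - eps_2 has been eliminated. *)
Definition positive_system (c : component) : root_sys :=
  match c with
  | cA r => RootSys (diffs (@eps r.+1)) [::]
  | cB r =>
      RootSys (diffs (@eps r) ++ sums (@eps r) ++ multiples 1 (@eps r)) [::]
  | cC r =>
      RootSys (diffs (@eps r) ++ sums (@eps r) ++ multiples 2%:R (@eps r)) [::]
  | cD r => RootSys (diffs (@eps r) ++ sums (@eps r)) [::]
  | cE6 =>
      let u (i : 'I_5) := @eps 8 (inord (4 - i)) in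
      RootSys (diffs u ++ sums u
               ++ half_spins (fun b : {ffun 'I_8 -> bool} =>
                    [&& ~~ b (inord 7), b (inord 6), b (inord 5)
                      & even_signs b])) [::]
  | cE7 =>
      let u (i : 'I_6) := @eps 8 (inord (5 - i)) in
      RootSys (diffs u ++ sums u
               ++ [:: @eps 8 (inord 7) - eps (inord 6)]
               ++ half_spins (fun b : {ffun 'I_8 -> bool} =>
                    [&& ~~ b (inord 7), b (inord 6) & even_signs b])) [::]
  | cE8 =>
      let u (i : 'I_8) := @eps 8 (rev_ord i) in
      RootSys (diffs u ++ sums u
               ++ half_spins (fun b : {ffun 'I_8 -> bool} =>
                    ~~ b (inord 7) && even_signs b)) [::]
  | cF4 =>
      RootSys (diffs (@eps 4) ++ sums (@eps 4) ++ multiples 1 (@eps 4)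
               ++ half_spins (fun b : {ffun 'I_4 -> bool} => ~~ b ord0)) [::]
  | cG2 =>
      let x := @eps 2 ord0 in let y := @eps 2 ord_max in
      RootSys [:: x; y; x + y; y - x; x *+ 2 + y; x + y *+ 2] [::]
  | sA m n =>
      let u (i : 'I_m.+1) := eps (lshift n.+1 i) in
      let d (j : 'I_n.+1) := eps (rshift m.+1 j) in
      RootSys (diffs u ++ diffs d) (cross_diffs u d)
  | sB m n =>
      let u (i : 'I_m) := eps (lshift n i) in
      let d (j : 'I_n) := eps (rshift m j) in
      RootSys (diffs d ++ sums d ++ multiples 2%:R d
               ++ diffs u ++ sums u ++ multiples 1 u)
              (cross_diffs d u ++ cross_sums d u ++ multiples 1 d)
  | sC n =>
      let u (i : 'I_1) := eps (lshift n.-1 i) in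
      let d (j : 'I_n.-1) := eps (rshift 1 j) in
      RootSys (diffs d ++ sums d ++ multiples 2%:R d)
              (cross_diffs u d ++ cross_sums u d)
  | sD m n =>
      let u (i : 'I_m) := eps (lshift n i) in
      let d (j : 'I_n) := eps (rshift m j) in
      RootSys (diffs d ++ sums d ++ multiples 2%:R d ++ diffs u ++ sums u)
              (cross_diffs d u ++ cross_sums d u)
  | sD21 =>
      RootSys (multiples 2%:R (@eps 3))
              [seq 2%:R *: v | v <- half_spins
                    (fun b : {ffun 'I_3 -> bool} => ~~ b ord0)]
  | sF4 =>
      let d := @eps 4 ord0 in
      let u (i : 'I_3) := @eps 4 (rshift 1 i) in
      RootSys (d :: diffs u ++ sums u ++ multiples 1 u)
              (half_spins (fun b : {ffun 'I_4 -> bool} => ~~ b ord0))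
  | sG3 =>
      let d := @eps 3 ord0 in
      let x := @eps 3 (inord 1) in let y := @eps 3 ord_max in
      RootSys [:: d *+ 2; x; y; x + y; y - x; x *+ 2 + y; x + y *+ 2]
              [:: d; d + x; d - x; d + y; d - y; d + (x + y); d - (x + y)]
  end.

Definition orth_sum (D1 D2 : root_sys) : root_sys :=
  RootSys
    ([seq row_mx v (0 : 'rV[rat]_(rdim D2)) | v <- even_roots D1]
     ++ [seq row_mx (0 : 'rV[rat]_(rdim D1)) v | v <- even_roots D2])
    ([seq row_mx v (0 : 'rV[rat]_(rdim D2)) | v <- odd_roots D1]
     ++ [seq row_mx (0 : 'rV[rat]_(rdim D1)) v | v <- odd_roots D2]).

(* A type is the list of its components. *)
Definition positive_system_of (t : seq component) : root_sys :=
  foldr (fun c D => orth_sum (positive_system c) D) (@RootSys 0 [::] [::]) t.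

(* Components of type A(0,0) do not contribute. *)
Definition splint_rank (t : seq component) : nat :=
  (\sum_(c <- t | ~~ is_A00 c) rank c)%N.

(* The types allowed for the two parts of a splint: nonempty sums, where
   A(0,0) is not mixed with components of another type. This exclusion is a
   genuine restriction: A(0,0) has no additive relations and no rank, so with
   mixed sums F(4) also has the splints (A1+B3+A(0,0), 7A(0,0)) and
   (A1+A3, 3A1+8A(0,0)), which are not equivalent to (A1+B3, 8A(0,0)). *)
Definition splint_type (t : seq component) : bool :=
  [&& (0 < size t)%N, all wf_component t
    & all is_A00 t || ~~ has is_A00 t].

Definition embedding (D D' : root_sys)
    (iota : 'rV[rat]_(rdim D) -> 'rV[rat]_(rdim D')) : Prop :=
  [/\ {in pos_roots D &, injective iota},
      forall a b, a \in pos_roots D -> b \in pos_roots D ->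
        a + b \in pos_roots D -> iota (a + b) = iota a + iota b,
      forall a, a \in even_roots D -> iota a \in even_roots D'
    & forall a, a \in odd_roots D -> iota a \in odd_roots D'].

Definition image_system (D : root_sys) (n : nat)
    (iota : 'rV[rat]_(rdim D) -> 'rV[rat]_n) : root_sys :=
  RootSys [seq iota a | a <- even_roots D] [seq iota a | a <- odd_roots D].

Definition splint (c : component) (t1 t2 : seq component)
    (iota1 : 'rV[rat]_(rdim (positive_system_of t1))
               -> 'rV[rat]_(rdim (positive_system c)))
    (iota2 : 'rV[rat]_(rdim (positive_system_of t2))
               -> 'rV[rat]_(rdim (positive_system c))) : Prop :=
  [/\ splint_type t1 && splint_type t2,
      embedding iota1 /\ embedding iota2,
      pos_roots (positive_system c)
        =i [predU pos_roots (image_system iota1) & pos_roots (image_system iota2)],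
      forall v, ~~ ((v \in pos_roots (image_system iota1))
                      && (v \in pos_roots (image_system iota2)))
    & (splint_rank t1 <= rank c)%N && (splint_rank t2 <= rank c)%N].

(* The invariant form of F(4): (eps_i, eps_j) is the Kronecker symbol,
   (delta, delta) = -3 and (delta, eps_i) = 0. *)
Definition F4_form (v w : 'rV[rat]_4) : rat :=
  \sum_(i < 4) (if i == ord0 then - 3%:R else 1) * (v 0 i * w 0 i).

Definition reflection (a v : 'rV[rat]_4) : 'rV[rat]_4 :=
  v - (2%:R * F4_form v a / F4_form a a) *: a.

Definition in_F4_weyl (sigma : 'rV[rat]_4 -> 'rV[rat]_4) : Prop :=
  exists2 s : seq 'rV[rat]_4,
    {subset s <= even_roots (positive_system sF4)}
    & forall v, sigma v = foldr reflection v s.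

Definition with_opposites n (s : seq 'rV[rat]_n) := s ++ [seq - v | v <- s].

Definition carries (sigma : 'rV[rat]_4 -> 'rV[rat]_4) (s s' : seq 'rV[rat]_4) :=
  [seq sigma v | v <- with_opposites s] =i with_opposites s'.

(* Each part of a splint is given as the image of its embedding. *)
Definition ordered_equiv
    (s1 s2 : seq 'rV[rat]_4 * seq 'rV[rat]_4)
    (s1' s2' : seq 'rV[rat]_4 * seq 'rV[rat]_4) : Prop :=
  exists2 sigma, in_F4_weyl sigma
    & [/\ carries sigma s1.1 s1'.1, carries sigma s1.2 s1'.2,
          carries sigma s2.1 s2'.1 & carries sigma s2.2 s2'.2].

Definition parts t (iota : 'rV[rat]_(rdim (positive_system_of t))
                             -> 'rV[rat]_(rdim (positive_system sF4))) :
    seq 'rV[rat]_4 * seq 'rV[rat]_4 :=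
  (even_roots (image_system iota), odd_roots (image_system iota)).

(* The order of the two parts of a splint is irrelevant. *)
Definition splint_equiv s1 s2 s1' s2' : Prop :=
  ordered_equiv s1 s2 s1' s2' \/ ordered_equiv s1 s2 s2' s1'.

(* Main.v *)
Require Import Defs.
From mathcomp Require Import all_boot all_order all_algebra.
From mathcomp Require Import lra zify.

Set Implicit Arguments.
Unset Strict Implicit.
Unset Printing Implicit Defensive.

Import Order.TTheory GRing.Theory Num.Theory.
Local Open Scope ring_scope.

(** The eight odd roots of F(4) are the vertices of a cube, and x and delta - x
    are antipodal vertices. Two facts govern everything: a sum of two odd roots
    that is a root must be delta ([F4_odd_sum]), and two odd roots that differ
    by an even root are never antipodal ([F4_odd_link]).

    The uniqueness claim reduces to: in every splint one part consists of the
    even roots and the other one of the odd roots. The identity is then an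
    equivalence with the given splint. This is shown as follows.

    - The components B(m,n), G(3), G2 and D(m,n) with n > 1 do not embed in
      F(4), and a component F(4) would leave nothing for the other part
      ([part_admissible]).
    - Counting the roots of the remaining components of rank at most 4 shows
      that a part that has an odd root, but is not a sum of copies of A(0,0),
      has fewer than 10 even roots and fewer than 8 odd ones
      ([odd_type_bounds]). As F(4) has 10 even and 8 odd roots, this settles the
      case where a part is a sum of copies of A(0,0) or is purely even. What
      remains is that each part has a component with both even and odd roots.
    - Each such component contains odd roots x, y for which y - x is an even
      root of that component ([component_chain2]). If the other part contains
      a chain x1, x2, x3, x4 of odd roots, where xj - xi is an even root of
      that part for i < j, then x and y are antipodal to two of the xi, and
      the even root y - x lies in both parts, or its opposite is positive
      ([chain4_excludes_chain2]). If the other part contains three antipodal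
      pairs, then x and y form the fourth one, which is impossible for two odd
      roots that differ by an even one ([pairs3_exclude_chain2]).
    - This excludes C(n), A(m,n) with m or n at least 3, and D(3,1). With
      what is left, 4 e + o < 24 for the numbers e and o of even and odd roots
      of each part, whereas 4 * 10 + 8 = 48. *)

(** * Families of vectors *)

Lemma mem_multiples n k (c : rat) (u : 'I_k -> 'rV[rat]_n) i :
  c *: u i \in multiples c u.
Proof. by apply: map_f; rewrite mem_enum. Qed.

Lemma mem_diffs n k (u : 'I_k -> 'rV[rat]_n) (i j : 'I_k) :
  (i < j)%N -> u i - u j \in diffs u.
Proof.
by move=> ij; apply/mapP; exists (i, j) => //; rewrite mem_filter ij mem_enum.
Qed.

Lemma mem_sums n k (u : 'I_k -> 'rV[rat]_n) (i j : 'I_k) :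
  (i < j)%N -> u i + u j \in sums u.
Proof.
by move=> ij; apply/mapP; exists (i, j) => //; rewrite mem_filter ij mem_enum.
Qed.

Lemma mem_cross_diffs n k l (u : 'I_k -> 'rV[rat]_n) (v : 'I_l -> _) i j :
  u i - v j \in cross_diffs u v.
Proof. by apply/mapP; exists (i, j) => //; rewrite mem_enum. Qed.

Lemma mem_cross_sums n k l (u : 'I_k -> 'rV[rat]_n) (v : 'I_l -> _) i j :
  u i + v j \in cross_sums u v.
Proof. by apply/mapP; exists (i, j) => //; rewrite mem_enum. Qed.

Lemma mem_half_spins n (P : pred {ffun 'I_n -> bool}) b :
  P b -> half_spin b \in half_spins P.
Proof. by move=> Pb; apply: map_f; rewrite mem_filter Pb mem_enum. Qed.

Lemma enum_ord_pairs k l :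
  enum {: 'I_k * 'I_l} = [seq (i, j) | i <- enum 'I_k, j <- enum 'I_l].
Proof. by rewrite enumT unlock. Qed.

(** Grouping the pairs by their larger entry j gives the sum of all j < k. *)
Lemma size_increasing_pairs k :
  size [seq p : 'I_k * 'I_k <- enum {: 'I_k * 'I_k} | (p.1 < p.2)%N] = 'C(k, 2).
Proof.
rewrite size_filter -sum1_count big_enum_cond /=.
rewrite -(pair_big_dep xpredT (fun i j : 'I_k => (i < j)%N) (fun _ _ => 1%N)) /=.
rewrite (exchange_big_dep xpredT) //= -bin2_sum big_mkord.
apply: eq_bigr => j _; rewrite sum1_card.
rewrite -[RHS]card_ord -[RHS](card_image (f := widen_ord (ltnW (ltn_ord j)))).
  apply: eq_card => i; apply/idP/imageP => [ij|[l _ ->]]; last exact: ltn_ord l.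
  by exists (Ordinal ij) => //; apply/val_inj.
by move=> a b /(congr1 val) /= /val_inj.
Qed.

Lemma size_multiples n k c (u : 'I_k -> 'rV[rat]_n) : size (multiples c u) = k.
Proof. by rewrite size_map size_enum_ord. Qed.

Lemma size_diffs n k (u : 'I_k -> 'rV[rat]_n) : size (diffs u) = 'C(k, 2).
Proof. by rewrite size_map size_increasing_pairs. Qed.

Lemma size_sums n k (u : 'I_k -> 'rV[rat]_n) : size (sums u) = 'C(k, 2).
Proof. by rewrite size_map size_increasing_pairs. Qed.

Lemma size_cross_diffs n k l (u : 'I_k -> 'rV[rat]_n) (v : 'I_l -> _) :
  size (cross_diffs u v) = (k * l)%N.
Proof. by rewrite size_map -cardE card_prod !card_ord. Qed.

Lemma size_cross_sums n k l (u : 'I_k -> 'rV[rat]_n) (v : 'I_l -> _) :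
  size (cross_sums u v) = (k * l)%N.
Proof. by rewrite size_map -cardE card_prod !card_ord. Qed.

Definition size_families := (size_cat, size_diffs, size_sums, size_multiples,
  size_cross_diffs, size_cross_sums).

(** The sign vectors with a plus sign in front form a product of finite sets. *)
Lemma size_half_spins0 n :
  size (half_spins (fun b : {ffun 'I_n.+1 -> bool} => ~~ b ord0)) = (2 ^ n)%N.
Proof.
pose A (i : 'I_n.+1) : pred bool := if i == ord0 then pred1 false else predT.
have -> : (2 ^ n)%N = #|(family A : simpl_pred {ffun 'I_n.+1 -> bool})|.
  rewrite card_family foldrE big_map big_enum /= big_ord_recl /= /A /= card1 mul1n.
  by rewrite (eq_bigr (fun _ => 2)) ?prod_nat_const ?card_ord //
    => i _; rewrite card_bool.
rewrite size_map size_filter -sum1_count big_enum_cond sum1_card /=.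
apply: eq_card => b; rewrite !unfold_in; apply/idP/forallP => [b0 i|/(_ ord0)].
  by rewrite /A unfold_in; have [->|] := eqVneq i ord0; rewrite //= (negPf b0).
by rewrite unfold_in /A /= => /eqP->.
Qed.

Lemma eps_inj n : injective (@eps n).
Proof.
move=> i j /rowP/(_ i); rewrite !mxE !eqxx.
by case: eqP => // _ /eqP; rewrite oner_eq0.
Qed.

Lemma half_spinE n (b : {ffun 'I_n -> bool}) i :
  half_spin b 0 i = (-1) ^+ b i / 2%:R.
Proof.
rewrite /half_spin mxE summxE (bigD1 i) //= big1 => [|j ji].
  by rewrite addr0 !mxE !eqxx mulr1 mulrC.
by rewrite !mxE eq_sym (negPf ji) andbF mulr0.
Qed.

Lemma half_spin_inj n : injective (@half_spin n).
Proof.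
move=> b b' /rowP bb'; apply/ffunP => i; have := bb' i.
by rewrite !half_spinE; case: (b i) (b' i) => -[].
Qed.

(** * The roots of F(4) *)

Local Notation F := (positive_system sF4).
Local Notation delta := (@eps 4 ord0).

(** In the order of the list of even roots of F(4). Facts on the even roots are
    checked on these ten vectors by computation. *)
Definition F4_even_coords : seq (seq int) :=
  [:: [:: 1; 0; 0; 0]; [:: 0; 1; -1; 0]; [:: 0; 1; 0; -1]; [:: 0; 0; 1; -1];
      [:: 0; 1; 1; 0]; [:: 0; 1; 0; 1]; [:: 0; 0; 1; 1];
      [:: 0; 1; 0; 0]; [:: 0; 0; 1; 0]; [:: 0; 0; 0; 1]].

Lemma F4_even_rootsE : even_roots F =
  [seq \row_(i < 4) (l`_i)%:~R | l : seq int <- F4_even_coords].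
Proof.
rewrite /= /diffs /sums /multiples.
rewrite enum_ord_pairs !enum_ordSl /= !enum_ord0 /=.
do ?congr (_ :: _); apply/rowP => -[[|[|[|[|//]]]] ?]; rewrite !mxE //=.
Qed.

Lemma F4_evenP e : e \in even_roots F ->
  exists2 l, l \in F4_even_coords & forall i, e 0 i = (l`_i)%:~R.
Proof. by rewrite F4_even_rootsE => /mapP[l Fl ->]; exists l => // i; rewrite mxE. Qed.

Lemma size_even_F4 : size (even_roots F) = 10%N.
Proof. by rewrite F4_even_rootsE size_map. Qed.

Lemma F4_even_uniq : uniq (even_roots F).
Proof.
pose coords (v : 'rV[rat]_4) := [seq v 0 (inord i) | i <- iota 0 4].
rewrite F4_even_rootsE; apply: (@map_uniq _ _ coords).
rewrite -map_comp (@eq_map _ _ _ (fun l => [seq (l`_i)%:~R | i <- iota 0 4])).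
  by vm_compute.
by move=> l; apply/eq_in_map => i; rewrite mem_iota => i4; rewrite mxE inordK.
Qed.

Lemma F4_even_coord e i : e \in even_roots F -> e 0 i \in [:: 0; 1; -1].
Proof.
case/F4_evenP=> l Fl ->; case: i => -[|[|[|[|//]]]] _ /=.
all: by move: l Fl; apply/allP; vm_compute.
Qed.

Lemma F4_even_coord0 e : e \in even_roots F -> e 0 0 = 1 -> e = delta.
Proof.
case/F4_evenP=> l Fl eE; rewrite eE => /eqP l0.
suff lE : l == [:: 1; 0; 0; 0].
  by apply/rowP => i; rewrite eE (eqP lE) !mxE; case: i => -[|[|[|[|//]]]].
by apply: implyP l0; move: l Fl {eE}; apply/allP; vm_compute.
Qed.

(** At most two coordinates of an even root are nonzero. *)
Lemma F4_even_norm e : e \in even_roots F -> \sum_i e 0 i ^+ 2 <= 2%:R.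
Proof.
case/F4_evenP=> l Fl eE; rewrite !big_ord_recl big_ord0 !eE.
by move: l Fl {eE}; apply/allP; vm_compute.
Qed.

(** A linear form, positive on the even roots, so that no even root has an even
    root as its opposite. *)
Definition height (v : 'rV[rat]_4) : rat := \sum_(i < 4) 2%:R ^+ (3 - i) * v 0 i.

Lemma heightB v w : height (v - w) = height v - height w.
Proof. by rewrite /height -sumrB; apply: eq_bigr => i _; rewrite !mxE mulrBr. Qed.

Lemma F4_even_height e : e \in even_roots F -> 0 < height e.
Proof.
case/F4_evenP=> l Fl eE; rewrite /height !big_ord_recl big_ord0 !eE.
by move: l Fl {eE}; apply/allP; vm_compute.
Qed.

Lemma F4_even0 : 0 \notin even_roots F.
Proof.
apply/negP => /F4_even_height.
by rewrite -[X in height X](subrr 0) heightB subrr ltxx.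
Qed.

Lemma F4_even_opp e : e \in even_roots F -> - e \notin even_roots F.
Proof.
move=> /F4_even_height e0; apply/negP => /F4_even_height.
have height0 : height 0 = 0 by rewrite -(subrr 0) heightB subrr.
by rewrite -sub0r heightB height0 sub0r oppr_gt0 ltNge ltW.
Qed.

(** The coordinates of an even root are at most 1 in absolute value, while those
    of a + 3 x and a differ by 3 wherever x is nonzero. *)
Lemma F4_even_string a x : a \in even_roots F -> x \in even_roots F ->
  a + x + x + x \notin even_roots F.
Proof.
move=> aF xF; apply/negP => bF; suff x0 : x = 0 by rewrite x0 (negPf F4_even0) in xF.
apply/rowP => i; have := F4_even_coord i bF.
have := F4_even_coord i aF; have := F4_even_coord i xF; rewrite !mxE !inE.
by do 2![case/or3P => /eqP->].
Qed.

(** An odd root has all coordinates 1/2 or -1/2, and delta-coordinate 1/2. *)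
Lemma F4_odd_rootsP (x : 'rV[rat]_4) :
 (x \in odd_roots F) = (x 0 0 == 2%:R^-1) && [forall i, x 0 i ^+ 2 == 4%:R^-1].
Proof.
apply/mapP/andP => [[b]|[/eqP x0 /forallP xi]].
- rewrite mem_filter => /andP[b0 _] ->; split.
    by rewrite half_spinE (negPf b0).
  by apply/forallP => i; rewrite half_spinE exprMn -exprM mulnC exprM sqrrN expr1n.
- exists [ffun i => x 0 i < 0].
  + by rewrite mem_filter mem_enum ffunE x0.
  + apply/rowP => i; rewrite half_spinE ffunE; have := xi i.
    have -> : 4%:R^-1 = (2%:R^-1) ^+ 2 :> rat by [].
    by rewrite eqf_sqr => /orP[] /eqP ->.
Qed.

Lemma F4_odd_coord0 x : x \in odd_roots F -> x 0 0 = 2%:R^-1.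
Proof. by rewrite F4_odd_rootsP => /andP[/eqP]. Qed.

Lemma F4_odd_coord x i : x \in odd_roots F -> x 0 i ^+ 2 = 4%:R^-1.
Proof. by rewrite F4_odd_rootsP => /andP[_ /forallP/(_ i)/eqP]. Qed.

Lemma F4_even_odd v : v \in even_roots F -> v \notin odd_roots F.
Proof.
by move/(F4_even_coord 0) => v0; apply/negP => /F4_odd_coord0 v0E; rewrite v0E in v0.
Qed.

Lemma F4_odd_uniq : uniq (odd_roots F).
Proof. by rewrite (map_inj_uniq (@half_spin_inj _)) filter_uniq ?enum_uniq. Qed.

Lemma size_odd_F4 : size (odd_roots F) = 8%N.
Proof. exact: size_half_spins0. Qed.

Lemma F4_uniq : uniq (pos_roots F).
Proof.
rewrite cat_uniq F4_even_uniq F4_odd_uniq andbT; apply/hasPn => x xO.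
by apply/negP => /F4_even_odd/negP.
Qed.

(** The delta-coordinate of the sum is 1, and delta is the only even root with
    that coordinate. *)
Lemma F4_odd_sum x y : x \in odd_roots F -> y \in odd_roots F ->
  x + y \in even_roots F -> x + y = delta.
Proof.
move=> Fx Fy Fxy; apply: F4_even_coord0 => //.
by rewrite mxE !F4_odd_coord0.
Qed.

Lemma F4_odd_double x : x \in odd_roots F -> x + x != delta.
Proof.
move=> Fx; apply/eqP => /rowP/(_ (lift 0 0)).
rewrite !mxE /= => x1; have := F4_odd_coord (lift 0 0) Fx.
have -> : x 0 (lift 0 0) = 0 by lra.
by [].
Qed.

Lemma F4_odd_opposite x : x \in odd_roots F -> delta - x \in odd_roots F.
Proof.
move=> Fx; rewrite F4_odd_rootsP; apply/andP; split.
  by rewrite !mxE F4_odd_coord0.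
apply/forallP => i; rewrite !mxE -(F4_odd_coord i Fx).
have [i0|_] := eqVneq i 0; last by rewrite sub0r sqrrN.
by rewrite i0 F4_odd_coord0.
Qed.

(** If y = delta - x, then y - x is the vector delta - 2 x, whose three epsilon
    coordinates are nonzero. *)
Lemma F4_odd_link x y : x \in odd_roots F -> y \in odd_roots F ->
  y - x \in even_roots F -> x + y != delta.
Proof.
move=> Fx Fy /F4_even_norm; apply: contraTneq => xy.
have -> : y - x = delta - x - x by rewrite -xy [x + y]addrC addrK.
have := fun i => F4_odd_coord i Fx; move: (F4_odd_coord0 Fx).
rewrite !big_ord_recl big_ord0 !mxE /= => x0 xi.
have := xi (lift ord0 ord0); have := xi (lift ord0 (lift ord0 ord0)).
have := xi (lift ord0 (lift ord0 (lift ord0 ord0))).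
(* The norm of delta - 2 x is 3, against 2 at most for an even root. *)
rewrite x0 -ltNge; nra.
Qed.

(** Four odd roots without antipodal pair, together with their antipodes, fill
    the whole cube of eight vertices. *)
Lemma F4_odd_antipodes s :
    {subset s <= odd_roots F} -> uniq s -> size s = 4%N ->
    {in s &, forall x y, x + y != delta} ->
  {in odd_roots F, forall z, z \notin s -> delta - z \in s}.
Proof.
move=> sF su s4 sA z Fz zs.
have [|||_ E] := @uniq_min_size _ (s ++ [seq delta - x | x <- s]) (odd_roots F).
- rewrite cat_uniq su map_inj_uniq ?su ?andbT; last first.
    by move=> x y /addrI/oppr_inj.
  apply/hasPn => _ /mapP[x xs ->]; apply/negP => /(sA _ _ xs).
  by rewrite addrC subrK eqxx.
- move=> x; rewrite mem_cat => /orP[/sF //|/mapP[y /sF yF ->]].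
  exact: F4_odd_opposite.
- by rewrite size_odd_F4 size_cat size_map s4.
move: Fz; rewrite -E mem_cat (negPf zs) => /mapP[x xs ->].
by rewrite opprB addrC subrK.
Qed.

(** * Embeddings *)

Lemma embedding_even D D' f x : @embedding D D' f ->
  x \in even_roots D -> f x \in even_roots D'.
Proof. by case=> _ _ + _; apply. Qed.

Lemma embedding_odd D D' f x : @embedding D D' f ->
  x \in odd_roots D -> f x \in odd_roots D'.
Proof. by case=> _ _ _; apply. Qed.

Lemma mem_pos_roots D x :
  (x \in pos_roots D) = (x \in even_roots D) || (x \in odd_roots D).
Proof. exact: mem_cat. Qed.

Lemma even_pos_roots D x : x \in even_roots D -> x \in pos_roots D.
Proof. by rewrite mem_cat => ->. Qed.

Lemma odd_pos_roots D x : x \in odd_roots D -> x \in pos_roots D.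
Proof. by rewrite mem_cat orbC => ->. Qed.

#[local] Hint Resolve even_pos_roots odd_pos_roots : core.

Lemma embedding_pos D D' f x : @embedding D D' f ->
  x \in pos_roots D -> f x \in pos_roots D'.
Proof.
move=> fE; rewrite mem_cat => /orP[].
  by move=> /(embedding_even fE)/even_pos_roots.
by move=> /(embedding_odd fE)/odd_pos_roots.
Qed.

Lemma embedding_sub D D' f x y : @embedding D D' f ->
  x \in pos_roots D -> y \in pos_roots D -> y - x \in pos_roots D ->
  f (y - x) = f y - f x.
Proof.
case=> _ fD _ _ xD yD yxD; have := fD _ _ yxD xD.
by rewrite subrK => /(_ yD) ->; rewrite addrK.
Qed.

Lemma embedding_comp D D' D'' f g :
  @embedding D D' f -> @embedding D' D'' g -> @embedding D D'' (g \o f).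
Proof.
move=> fE gE; have [[fi fD f0 f1] [gi gD g0 g1]] := (fE, gE).
split=> [a b Da Db|a b Da Db Dab|a /f0/g0|a /f1/g1] //=.
  by move=> /gi/fi; apply=> //; apply: embedding_pos fE _.
by rewrite fD // gD -?fD //; apply: embedding_pos fE _.
Qed.

Lemma additive_embedding D D' (f : 'rV_(rdim D) -> 'rV_(rdim D')) :
    {morph f : x y / x + y} -> {in pos_roots D &, injective f} ->
    {subset map f (even_roots D) <= even_roots D'} ->
    {subset map f (odd_roots D) <= odd_roots D'} ->
  embedding f.
Proof.
by move=> fD fi f0 f1; split=> // a Da; [apply: f0 | apply: f1]; apply: map_f.
Qed.

Definition embeds D D' := exists f, @embedding D D' f.

Lemma embeds_trans D D' D'' : embeds D D' -> embeds D' D'' -> embeds D D''.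
Proof. by move=> [f fE] [g gE]; exists (g \o f); apply: embedding_comp fE gE. Qed.

Lemma embeds_suml D1 D2 : embeds D1 (orth_sum D1 D2).
Proof.
exists (fun v => row_mx v 0); apply: additive_embedding.
- by move=> x y; rewrite add_row_mx addr0.
- by move=> x y _ _ /eq_row_mx[].
- by move=> v vD; rewrite mem_cat vD.
- by move=> v vD; rewrite mem_cat vD.
Qed.

Lemma embeds_sumr D1 D2 : embeds D2 (orth_sum D1 D2).
Proof.
exists (fun v => row_mx 0 v); apply: additive_embedding.
- by move=> x y; rewrite add_row_mx addr0.
- by move=> x y _ _ /eq_row_mx[].
- by move=> v vD; rewrite mem_cat vD orbT.
- by move=> v vD; rewrite mem_cat vD orbT.
Qed.

(** A property of all components that embed in D holds for the components of
    every type that embeds in D. Obstructions are thus proved component by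
    component. *)
Lemma all_components (P : pred component) D t :
    (forall c, wf_component c -> embeds (positive_system c) D -> P c) ->
    all wf_component t -> embeds (positive_system_of t) D ->
  all P t.
Proof.
move=> PD; elim: t => //= c t IHt /andP[wc wt] tD; apply/andP; split.
  by apply: PD => //; apply: embeds_trans tD; apply: embeds_suml.
by apply: IHt => //; apply: embeds_trans tD; apply: embeds_sumr.
Qed.

(** * Chains and complementary pairs of odd roots *)

(** Such a sequence of odd roots is preserved by every embedding, and no two of
    its members are antipodal in F(4). *)
Definition chain D (s : seq 'rV_(rdim D)) :=
  all (mem (odd_roots D)) s && pairwise (fun x y => y - x \in even_roots D) s.

Definition has_chain k D := exists2 s, @chain D s & size s = k.

Lemma has_chain_le k l D : (l <= k)%N -> has_chain k D -> has_chain l D.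
Proof.
move=> lk [s /andP[s1 sP] sk]; exists (take l s); last first.
  by rewrite size_takel ?sk.
have ss : subseq (take l s) s by rewrite -{2}(cat_take_drop l s) prefix_subseq.
apply/andP; split; last exact: subseq_pairwise ss sP.
by apply/allP => x /(mem_subseq ss); apply: (allP s1).
Qed.

Lemma embeds_chain k D D' : embeds D D' -> has_chain k D -> has_chain k D'.
Proof.
move=> [f fE] [s /andP[sD sP] sk]; exists (map f s); last by rewrite size_map.
apply/andP; split.
  apply/allP => _ /mapP[x /(allP sD) xD ->]; exact: embedding_odd fE xD.
rewrite pairwise_map; apply: sub_in_pairwise sD sP => x y xD yD yxD /=.
rewrite -(embedding_sub fE) ?(odd_pos_roots xD) ?(odd_pos_roots yD) //.
  exact: embedding_even fE yxD.
exact: even_pos_roots.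
Qed.

(** Any pair x, e - x is mapped by an embedding in F(4) to an antipodal pair,
    since e is then mapped to delta. *)
Definition has_pairs k D := exists (e : 'rV_(rdim D)) s,
  [/\ e \in even_roots D, {subset s ++ [seq e - x | x <- s] <= odd_roots D},
      uniq (s ++ [seq e - x | x <- s]) & size s = k].

Lemma embeds_pairs k D D' : embeds D D' -> has_pairs k D -> has_pairs k D'.
Proof.
move=> [f fE] [e [s [eD sD su sk]]]; exists (f e), (map f s).
have -> : map f s ++ [seq f e - x | x <- map f s]
        = map f (s ++ [seq e - x | x <- s]).
  rewrite map_cat -!map_comp; congr cat; apply/eq_in_map => x xs /=.
  have [xD exD] : x \in odd_roots D /\ e - x \in odd_roots D.
    by split; apply: sD; rewrite mem_cat ?xs // (map_f (fun y => e - y)) ?orbT.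
  by rewrite (embedding_sub fE) ?(odd_pos_roots xD) ?(odd_pos_roots exD)
    ?(even_pos_roots eD).
split; rewrite ?size_map //; first exact: embedding_even fE eD.
  by move=> _ /mapP[x /sD xD ->]; apply: embedding_odd fE xD.
rewrite map_inj_in_uniq // => x y /sD/odd_pos_roots xD /sD/odd_pos_roots yD.
by case: fE => fi _ _ _; apply: fi.
Qed.

(** * Partitions of the roots of F(4) *)

Definition splits_into (T : eqType) (s s1 s2 : seq T) :=
  s =i [predU s1 & s2] /\ forall x, ~~ ((x \in s1) && (x \in s2)).

Lemma splits_into_sym (T : eqType) (s s1 s2 : seq T) :
  splits_into s s1 s2 -> splits_into s s2 s1.
Proof.
by move=> [sE sd]; split=> x; [rewrite sE !inE orbC | rewrite andbC].
Qed.

Lemma splits_into_l (T : eqType) (s s1 s2 : seq T) :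
  splits_into s s1 s2 -> {subset s1 <= s}.
Proof. by move=> [sE _] x; rewrite sE inE => ->. Qed.

Section SplitF4.

Variables E1 O1 E2 O2 : seq 'rV[rat]_4.
Hypothesis splitE : splits_into (even_roots F) E1 E2.
Hypothesis splitO : splits_into (odd_roots F) O1 O2.

Let E1F := splits_into_l splitE.
Let O1F := splits_into_l splitO.
Let E2F := splits_into_l (splits_into_sym splitE).
Let O2F := splits_into_l (splits_into_sym splitO).

(** The four members of the chain and their antipodes are all the odd roots, so
    the second part lies in the set of antipodes. Differences of antipodes are
    differences of members of the chain, which belong to the first part. *)
Lemma chain4_excludes_chain2 :
  has_chain 4 (RootSys E1 O1) -> ~ has_chain 2 (RootSys E2 O2).
Proof.
move=> [s /andP[/allP /= sO sP] s4] [[|z [|w []]] // /andP[]] /=.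
rewrite !andbT => /andP[zO wO] wzE _.
have su : uniq s.
  apply: pairwise_uniq sP => x; rewrite subrr.
  by apply/negP => /E1F; apply/negP/F4_even0.
have sL x y : x \in s -> y \in s -> [|| x == y, y - x \in E1 | x - y \in E1].
  move=> xs ys; move: (sP) => /(pairwiseP 0) sN.
  have := nth_index 0 xs; have := nth_index 0 ys.
  have: (index x s < size s)%N by rewrite index_mem.
  have: (index y s < size s)%N by rewrite index_mem.
  case: (ltngtP (index x s) (index y s)) => [lt|lt|->] ly lx ey ex.
  - by have := sN _ _ lx ly lt; rewrite ex ey => ->; rewrite orbT.
  - by have := sN _ _ ly lx lt; rewrite ex ey => ->; rewrite !orbT.
  - by rewrite -[X in X == _]ex ey eqxx.
have sA : {in s &, forall x y, x + y != delta}.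
  move=> x y xs ys; have [xF yF] := (O1F (sO _ xs), O1F (sO _ ys)).
  case/or3P: (sL x y xs ys) => [/eqP<-|/E1F|/E1F].
  - exact: F4_odd_double.
  - exact: F4_odd_link xF yF.
  - by rewrite [x + y]addrC; apply: F4_odd_link yF xF.
(* An odd root of the second part is not in the chain, so its antipode is. *)
have anti v : v \in O2 -> delta - v \in s.
  move=> vO; apply: F4_odd_antipodes (O2F vO) _ => // [x /sO/O1F //|].
  by apply/negP => /sO vO1; have [_ /(_ v)] := splitO; rewrite vO1 vO.
(* The even root w - z of the second part is the difference of the antipodes
   of z and w, taken in the opposite order. *)
have {}wzE : (delta - z) - (delta - w) \in E2 by rewrite opprB addrC addrA subrK.
have /or3P[/eqP zw|zw|zw] := sL _ _ (anti _ zO) (anti _ wO).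
- by have := F4_even0; rewrite -(subrr (delta - z)) {2}zw (E2F wzE).
- by have /negP := F4_even_opp (E2F wzE); apply; rewrite opprB E1F.
- by have [_ /(_ (delta - z - (delta - w)))] := splitE; rewrite zw wzE.
Qed.

(** The odd roots outside three antipodal pairs form an antipodal pair. *)
Lemma pairs3_exclude_chain2 :
  has_pairs 3 (RootSys E1 O1) -> ~ has_chain 2 (RootSys E2 O2).
Proof.
move=> [e [s [eE sO su s3]]] [[|z [|w []]] // /andP[]] /=.
rewrite !andbT => /andP[zO wO] wzE _.
have sO1 x : x \in s -> x \in O1 by move=> xs; apply: sO; rewrite mem_cat xs.
have ed x : x \in s -> e = delta.
  move=> xs; have xF := O1F (sO1 _ xs).
  have eF : e - x \in odd_roots F.
    by apply/O1F/sO; rewrite mem_cat (map_f (fun y => e - y)) ?orbT.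
  by rewrite -(F4_odd_sum eF xF) subrK // E1F.
have sO2 x : x \in s -> delta - x \in O1.
  move=> xs; rewrite -(ed _ xs); apply: sO.
  by rewrite mem_cat (map_f (fun y => e - y)) ?orbT.
have notO1 v : v \in O2 -> v \notin O1.
  by move=> vO; apply/negP => vO1; have [_ /(_ v)] := splitO; rewrite vO vO1.
have sA x y : x \in s -> y \in s -> x + y != delta.
  move=> xs ys; apply/eqP => xy.
  have ys' : y \in [seq e - x | x <- s].
    by rewrite -(addKr x y) xy addrC -(ed _ xs) (map_f (fun y => e - y)).
  by move: su; rewrite cat_uniq => /and3P[_ /hasPn/(_ _ ys')/negP[]].
have zsA x : x \in s -> x + z != delta.
  move=> xs; apply: contraNneq (notO1 _ zO) => xz.
  by rewrite -(addKr x z) xz addrC sO2.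
have [zF wF] := (O2F zO, O2F wO).
(* One member of each pair together with z: four odd roots, no two of them
   antipodal. As w is none of them, its antipode is one of them. *)
have: delta - w \in z :: s.
  apply: F4_odd_antipodes wF _ => [x||||].
  - by rewrite inE => /predU1P[-> //|/sO1/O1F].
  - move: su; rewrite cat_uniq /= => /and3P[-> _ _]; rewrite andbT.
    by apply: contra (notO1 _ zO) => /sO1.
  - by rewrite /= s3.
  - move=> x y; rewrite !inE => /predU1P[->|xs] /predU1P[->|ys].
    + exact: F4_odd_double.
    + by rewrite addrC zsA.
    + exact: zsA.
    + exact: sA.
  - rewrite inE negb_or; apply/andP; split.
      by apply: contraTneq (E2F wzE) => ->; rewrite subrr F4_even0.
    by apply: contra (notO1 _ wO) => /sO1.
rewrite inE => /predU1P[wz|ws].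
  by have := F4_odd_link zF wF (E2F wzE); rewrite -wz subrK eqxx.
by have /negP := notO1 _ wO; apply; rewrite -(subKr delta w) sO2.
Qed.

End SplitF4.

(** * Components that do not embed in F(4) *)

(** All even roots that are sums of two odd roots collide under an embedding in
    F(4). *)
Lemma embeds_F4_odd_sum D f x y : @embedding D F f ->
    x \in odd_roots D -> y \in odd_roots D -> x + y \in even_roots D ->
  f (x + y) = delta.
Proof.
move=> fE xD yD xyD; case: (fE) => _ fD f0 f1; have := f0 _ xyD.
rewrite fD ?(odd_pos_roots xD) ?(odd_pos_roots yD) ?(even_pos_roots xyD) //.
by move=> /F4_odd_sum; apply; apply: f1.
Qed.

Lemma embeds_F4_odd_double D x : embeds D F ->
  x \in odd_roots D -> x + x \notin even_roots D.
Proof.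
move=> [f fE] xD; apply/negP => xxD; have /eqP := embeds_F4_odd_sum fE xD xD xxD.
case: (fE) => _ fD _ f1.
by rewrite fD ?(odd_pos_roots xD) ?(even_pos_roots xxD) //; apply/negP/F4_odd_double/f1.
Qed.

Lemma embeds_F4_string D a x : embeds D F ->
    a \in even_roots D -> x \in even_roots D -> a + x \in even_roots D ->
    a + x + x \in even_roots D ->
  a + x + x + x \notin even_roots D.
Proof.
move=> [f [_ fD f0 _]] aD xD axD axxD; apply/negP => axxxD.
have := F4_even_string (f0 _ aD) (f0 _ xD).
by rewrite -!fD ?f0 ?(even_pos_roots xD) // even_pos_roots.
Qed.

(** Here delta_1 and 2 delta_1 are both roots. *)
Lemma sB_not_embeds m n : (1 <= n)%N -> ~ embeds (positive_system (sB m n)) F.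
Proof.
case: n => // n _ DF; pose d (j : 'I_n.+1) := eps (rshift m j).
have [d0 d00] : d ord0 \in odd_roots (positive_system (sB m n.+1)) /\
    2%:R *: d ord0 \in even_roots (positive_system (sB m n.+1)).
  split; rewrite /= !mem_cat ?(mem_multiples 2%:R d) ?orbT //.
  by rewrite -{3}(scale1r (d ord0)) (mem_multiples 1 d) !orbT.
by have := embeds_F4_odd_double DF d0; rewrite -mulr2n -scaler_nat d00.
Qed.

(** Here delta and 2 delta are both roots. *)
Lemma sG3_not_embeds : ~ embeds (positive_system sG3) F.
Proof.
move/(@embeds_F4_odd_double (positive_system sG3) (@eps 3 ord0)).
by rewrite !inE eqxx => /(_ isT)/negP; apply; rewrite -mulr2n eqxx.
Qed.

(** The roots 2 delta_1 and 2 delta_2 are distinct, and each of them is a sum of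
    two odd roots. *)
Lemma sD_not_embeds m n :
  (2 <= m)%N -> (2 <= n)%N -> ~ embeds (positive_system (sD m n)) F.
Proof.
case: m n => [|[|m]] // [|[|n]] // _ _ [f fE].
pose u (i : 'I_m.+2) := eps (lshift n.+2 i).
pose d (j : 'I_n.+2) := eps (rshift m.+2 j).
have dd j : 2%:R *: d j \in even_roots (positive_system (sD m.+2 n.+2)).
  by rewrite /= !mem_cat mem_multiples !orbT.
have fd j : f (2%:R *: d j) = delta.
  have E : d j - u ord0 + (d j + u ord0) = 2%:R *: d j.
    by rewrite addrCA subrK scaler_nat.
  rewrite -E; apply: (embeds_F4_odd_sum fE); last by rewrite E dd.
    by rewrite /= mem_cat (mem_cross_diffs d u).
  by rewrite /= mem_cat (mem_cross_sums d u) orbT.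
case: (fE) => fi _ _ _.
have dpos j := even_pos_roots (dd j).
have /scalerI := fi _ _ (dpos ord0) (dpos (lift ord0 ord0))
  (etrans (fd _) (esym (fd _))).
by move=> /(_ isT)/eps_inj/rshift_inj.
Qed.

(** The string y - x, y, y + x, y + 2 x is too long for F(4). *)
Lemma cG2_not_embeds : ~ embeds (positive_system cG2) F.
Proof.
pose x := @eps 2 ord0; pose y := @eps 2 ord_max.
move/(@embeds_F4_string (positive_system cG2) (y - x) x).
rewrite subrK [y + x]addrC [_ + x]addrC addrA -mulr2n /= -/x -/y.
by move: x y => x y; rewrite !inE !eqxx !orbT => /(_ isT isT isT isT).
Qed.

(** The components not excluded from F(4) by the preceding lemmas; F(4) itself is
    left out because it embeds onto all of F(4), so that the other part of the
    splint would be empty. *)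
Definition admissible (c : component) : bool :=
  match c with
  | cG2 | sB _ _ | sF4 | sG3 => false
  | sD _ n => (n <= 1)%N
  | _ => true
  end.

(** * Chains and complementary pairs in the components *)

Lemma ltn_enum_ord n : pairwise (fun i j : 'I_n => (i < j)%N) (enum 'I_n).
Proof.
rewrite -(pairwise_map val ltn) val_enum_ord -sorted_pairwise ?iota_ltn_sorted //.
exact: ltn_trans.
Qed.

(** The chain is u_m - d_0, ..., u_0 - d_0; the order is reversed because u_i - u_j
    is positive for i < j. *)
Lemma sA_chain_l m n : has_chain m.+1 (positive_system (sA m n)).
Proof.
pose u (i : 'I_m.+1) := eps (lshift n.+1 i).
pose d (j : 'I_n.+1) := eps (rshift m.+1 j).
exists [seq u (rev_ord i) - d ord0 | i <- enum 'I_m.+1]; last first.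
  by rewrite size_map size_enum_ord.
apply/andP; split; first by apply/allP => _ /mapP[i _ ->]; apply: mem_cross_diffs.
rewrite pairwise_map; apply: sub_pairwise (ltn_enum_ord _) => i j ij /=.
rewrite opprB addrA subrK mem_cat (mem_diffs u) //=.
have := ltn_ord j; lia.
Qed.

(** The chain is u_0 - d_0, ..., u_0 - d_n. *)
Lemma sA_chain_r m n : has_chain n.+1 (positive_system (sA m n)).
Proof.
pose u (i : 'I_m.+1) := eps (lshift n.+1 i).
pose d (j : 'I_n.+1) := eps (rshift m.+1 j).
exists [seq u ord0 - d j | j <- enum 'I_n.+1]; last first.
  by rewrite size_map size_enum_ord.
apply/andP; split; first by apply/allP => _ /mapP[i _ ->]; apply: mem_cross_diffs.
rewrite pairwise_map; apply: sub_pairwise (ltn_enum_ord _) => i j ij /=.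
by rewrite opprB [u _ - _]addrC addrACA subrr addr0 addrC mem_cat (mem_diffs d) ?orbT.
Qed.

(** The chain is u - d_0, u - d_1, u + d_1, u + d_0. *)
Lemma sC_chain n : (3 <= n)%N -> has_chain 4 (positive_system (sC n)).
Proof.
case: n => [|[|[|n]]] // _.
pose u (i : 'I_1) := @eps (1 + n.+2) (lshift n.+2 i).
pose d (j : 'I_n.+2) := eps (rshift 1 j).
pose a := u ord0; pose b := d ord0; pose c := d (lift ord0 ord0).
exists [:: a - b; a - c; a + c; a + b] => //.
apply/andP; split.
  by rewrite /= !mem_cat !mem_cross_diffs !mem_cross_sums ?orbT.
have E x y z : x + y - (x + z) = y - z :> 'rV[rat]_(1 + n.+2).
  by rewrite opprD addrACA subrr add0r.
rewrite /= !E !opprK [- c + _]addrC -!mulr2n -!scaler_nat.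
have [bc bc' bb cc] : [/\ b - c \in diffs d, b + c \in sums d,
    2%:R *: b \in multiples 2%:R d & 2%:R *: c \in multiples 2%:R d].
  by rewrite mem_diffs ?mem_sums ?mem_multiples.
rewrite ![c + b]addrC !mem_cat.
by rewrite bc bc' bb cc !orbT.
Qed.

(** The pairs are d_0 + u_i and d_0 - u_i. *)
Lemma sD_pairs m n : (1 <= n)%N -> has_pairs m (positive_system (sD m n)).
Proof.
case: n => // n _.
pose u (i : 'I_m) := eps (lshift n.+1 i).
pose d (j : 'I_n.+1) := eps (rshift m j).
exists (2%:R *: d ord0), [seq d ord0 + u i | i <- enum 'I_m].
have E : [seq 2%:R *: d ord0 - x | x <- [seq d ord0 + u i | i <- enum 'I_m]]
       = [seq d ord0 - u i | i <- enum 'I_m].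
  rewrite -map_comp; apply: eq_map => i /=.
  by rewrite scaler_nat opprD addrA addrK.
have ui : injective u by move=> i j /eps_inj/lshift_inj.
rewrite E; split.
- by rewrite /= !mem_cat mem_multiples !orbT.
- move=> x; rewrite !mem_cat => /orP[] /mapP[i _ ->].
    by rewrite (mem_cross_sums d u) orbT.
  by rewrite (mem_cross_diffs d u).
- have dDu : injective (fun i => d ord0 + u i) by move=> i j /addrI/ui.
  have dBu : injective (fun i => d ord0 - u i) by move=> i j /addrI/oppr_inj/ui.
  rewrite cat_uniq (map_inj_uniq dDu) (map_inj_uniq dBu) enum_uniq andbT /=.
  apply/hasPn => _ /mapP[i _ ->]; apply/negP.
  move=> /mapP[j _ /addrI/rowP/(_ (lshift n.+1 j))].
  rewrite !mxE !eqxx (inj_eq (@lshift_inj _ _)) /=.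
  by case: eqP.
- by rewrite size_map size_enum_ord.
Qed.

Lemma sD_chain m n : (2 <= m)%N -> (1 <= n)%N -> has_chain 2 (positive_system (sD m n)).
Proof.
case: m n => [|[|m]] // [|n] // _ _.
pose u (i : 'I_m.+2) := eps (lshift n.+1 i).
pose d (j : 'I_n.+1) := eps (rshift m.+2 j).
exists [:: d ord0 - u ord0; d ord0 - u (lift ord0 ord0)] => //.
apply/andP; split; first by rewrite /= !mem_cat !(mem_cross_diffs d u).
rewrite /= opprB addrC addrA subrK !mem_cat (mem_diffs u) //.
by rewrite !orbT.
Qed.

Lemma sD21_chain : has_chain 2 (positive_system sD21).
Proof.
pose b k := [ffun i : 'I_3 => (k < i)%N].
exists [:: 2%:R *: half_spin (b 0); 2%:R *: half_spin (b 1)] => //.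
apply/andP; split.
  by rewrite /= !(map_f ( *:%R 2%:R)) // mem_half_spins // ffunE.
rewrite /= !andbT; apply/mapP; exists (lift ord0 ord0); first by rewrite mem_enum.
have hE (c : {ffun 'I_3 -> bool}) i : (2%:R *: half_spin c) 0 i = (-1) ^+ c i.
  by rewrite mxE half_spinE mulrC divfK.
apply/rowP => i; rewrite [LHS]mxE hE [X in _ + X]mxE hE !ffunE !mxE.
by case: i => -[|[|[|//]]].
Qed.

(** * Numbers of roots *)

Definition even_count c := size (even_roots (positive_system c)).

Definition odd_count c := size (odd_roots (positive_system c)).

Lemma even_count_sA m n : even_count (sA m n) = ('C(m.+1, 2) + 'C(n.+1, 2))%N.
Proof. by rewrite /even_count /= !size_families. Qed.

Lemma odd_count_sA m n : odd_count (sA m n) = (m.+1 * n.+1)%N.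
Proof. by rewrite /odd_count /= !size_families. Qed.

Lemma even_count_sC n :
  even_count (sC n) = ('C(n.-1, 2) + ('C(n.-1, 2) + n.-1))%N.
Proof. by rewrite /even_count /= !size_families. Qed.

Lemma odd_count_sC n : odd_count (sC n) = (n.-1 + n.-1)%N.
Proof. by rewrite /odd_count /= !size_families !mul1n. Qed.

Lemma even_count_sD m n : even_count (sD m n) =
  ('C(n, 2) + ('C(n, 2) + (n + ('C(m, 2) + 'C(m, 2)))))%N.
Proof. by rewrite /even_count /= !size_families. Qed.

Lemma odd_count_sD m n : odd_count (sD m n) = (n * m + n * m)%N.
Proof. by rewrite /odd_count /= !size_families. Qed.

Lemma even_count_sD21 : even_count sD21 = 3%N.
Proof. by rewrite /even_count /= size_multiples. Qed.

Lemma odd_count_sD21 : odd_count sD21 = 4%N.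
Proof. by rewrite /odd_count /= size_map size_half_spins0. Qed.

Lemma component_nonempty c : wf_component c -> (0 < even_count c + odd_count c)%N.
Proof.
case: c => [r|r|r|r||||||m n|m n|n|m n|||] //=.
all: rewrite ?even_count_sA ?odd_count_sA ?even_count_sC ?odd_count_sC.
all: rewrite ?even_count_sD ?odd_count_sD ?even_count_sD21 //.
all: rewrite /even_count /odd_count /= ?size_families //.
all: try (rewrite ?addn0 ?addn_gt0 ?bin_gt0; lia).
Qed.

Lemma size_even_sum t :
  size (even_roots (positive_system_of t)) = (\sum_(c <- t) even_count c)%N.
Proof.
elim: t => [|c t IHt] /=; first by rewrite big_nil.
by rewrite big_cons size_cat !size_map IHt.
Qed.

Lemma size_odd_sum t :
  size (odd_roots (positive_system_of t)) = (\sum_(c <- t) odd_count c)%N.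
Proof.
elim: t => [|c t IHt] /=; first by rewrite big_nil.
by rewrite big_cons size_cat !size_map IHt.
Qed.

(** What the obstructions to embedding leave for a part that is not a sum of copies
    of A(0,0). *)
Definition viable_component c :=
  [&& wf_component c, ~~ is_A00 c & admissible c].

(** Among the viable components of rank at most 4, those that have neither a chain
    of length four nor three complementary pairs. *)
Definition short_component c :=
  match c with
  | sA m n => (m <= 2)%N && (n <= 2)%N
  | sC _ => false
  | sD m _ => m != 3%N
  | _ => true
  end.

Lemma component_chain2 c :
  viable_component c -> (0 < odd_count c)%N -> has_chain 2 (positive_system c).
Proof.
move=> /and3P[]; case: c => //=.
- case=> [|m] [|n] // _ _ _ _; first exact: has_chain_le (sA_chain_r 0 n.+1).
    exact: has_chain_le (sA_chain_l m.+1 0).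
  exact: has_chain_le (sA_chain_l m.+1 n.+1).
- by move=> n n3 _ _ _; apply: has_chain_le (sC_chain n3).
- by move=> m n /andP[m2 n1] _ _ _; apply: sD_chain.
- by move=> *; apply: sD21_chain.
Qed.

(** The term (4 - rank c)^2 is room for the other components of the same type:
    see [sum_le_square]. The weight 4 e + o is chosen so that the last bound is
    half of 4 * 10 + 8. *)
Lemma odd_component_bounds c :
    viable_component c -> (rank c <= 4)%N -> (0 < odd_count c)%N ->
  [/\ (1 < rank c)%N, (even_count c + (4 - rank c) ^ 2 < 10)%N,
      (odd_count c + (4 - rank c) ^ 2 < 8)%N &
      short_component c ->
        (4 * even_count c + odd_count c + 4 * (4 - rank c) ^ 2 < 24)%N].
Proof.
move=> /and3P[]; case: c => //.
- move=> m n _ + _; rewrite even_count_sA odd_count_sA.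
  by case: m n => [|[|[|[|m]]]] [|[|[|[|n]]]] //=; rewrite ?addnS ?addSn.
- move=> n; rewrite even_count_sC odd_count_sC.
  by case: n => [|[|[|[|[|n]]]]] //=; rewrite ?addnS ?addSn.
- move=> m n; rewrite even_count_sD odd_count_sD.
  by case: n m => [|[|n]] [|[|[|[|m]]]] //=; rewrite ?addnS ?addSn.
- by rewrite even_count_sD21 odd_count_sD21.
Qed.

Lemma small_component_bounds c :
    viable_component c -> (rank c <= 2)%N ->
  [/\ (even_count c <= rank c ^ 2)%N, (odd_count c <= rank c ^ 2)%N
    & (4 * even_count c + odd_count c <= 4 * rank c ^ 2)%N].
Proof.
move=> /and3P[]; case: c => //.
- by move=> r; rewrite /even_count /odd_count /= !size_families; case: r => [|[|[|r]]].
- by move=> r; rewrite /even_count /odd_count /= !size_families; case: r => [|[|[|r]]].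
- by move=> r; rewrite /even_count /odd_count /= !size_families; case: r => [|[|[|r]]].
- by move=> r; rewrite /even_count /odd_count /= !size_families; case: r => [|[|[|r]]].
- move=> m n _ + _; rewrite even_count_sA odd_count_sA.
  by case: m n => [|[|m]] [|[|n]] //=; rewrite ?addnS ?addSn.
- move=> n; rewrite even_count_sC odd_count_sC.
  by case: n => [|[|[|n]]].
- move=> m n; rewrite even_count_sD odd_count_sD.
  by case: n => [|[|n]]; case: m => [|[|[|[|m]]]].
Qed.

(** A bound by the square of the rank passes from components to their sums, as
    the sum of the squares is at most the square of the sum. *)
Lemma sum_le_square (P : pred component) f K s :
    (forall c, P c -> (rank c <= 2)%N -> (f c <= K * rank c ^ 2)%N) ->
    all P s -> (\sum_(c <- s) rank c <= 2)%N ->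
  (\sum_(c <- s) f c <= K * (\sum_(c <- s) rank c) ^ 2)%N.
Proof.
move=> fK; elim: s => [|c s IHs] /=; first by rewrite !big_nil.
move=> /andP[Pc Ps]; rewrite !big_cons => rs.
have {}IHs := IHs Ps (leq_trans (leq_addl _ _) rs).
have {}fK := fK _ Pc (leq_trans (leq_addr _ _) rs).
apply: leq_trans (leq_add fK IHs) _; rewrite -mulnDr leq_mul2l sqrnD.
by rewrite leq_addr orbT.
Qed.

(** Once a component c with property Q is split off, the other ones have total rank
    at most 4 - rank c, hence at most 2, so that [sum_le_square] applies. *)
Lemma sum_bound (P Q : pred component) f K B t :
    (forall c, P c -> (rank c <= 2)%N -> (f c <= K * rank c ^ 2)%N) ->
    (forall c, P c -> Q c -> (rank c <= 4)%N ->
       (1 < rank c)%N /\ (f c + K * (4 - rank c) ^ 2 < B)%N) ->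
    all P t -> has Q t -> (\sum_(c <- t) rank c <= 4)%N ->
  (\sum_(c <- t) f c < B)%N.
Proof.
move=> fK fB Pt Qt; case: (split_find Qt) Pt => c s1 s2 Qc _.
rewrite all_cat all_rcons => /andP[/andP[Pc P1] P2].
have E g : (\sum_(c <- rcons s1 c ++ s2) g c = g c + \sum_(c <- s1 ++ s2) g c)%N.
  by rewrite !big_cat -cats1 big_cat /= big_seq1 addnCA addnA.
rewrite !E => r4; have [|r1 {}fB] := fB c Pc Qc; first by lia.
apply: leq_ltn_trans fB; rewrite leq_add2l.
apply: leq_trans (sum_le_square fK _ _) _; rewrite ?all_cat ?P1 //; first by lia.
by rewrite leq_mul2l leq_exp2r ?leq_subRL ?orbT //; lia.
Qed.

Lemma odd_type_bounds t :
    all viable_component t -> has (fun c => 0 < odd_count c)%N t ->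
    (\sum_(c <- t) rank c <= 4)%N ->
  [/\ (\sum_(c <- t) even_count c < 10)%N, (\sum_(c <- t) odd_count c < 8)%N
    & all short_component t ->
      (4 * \sum_(c <- t) even_count c + \sum_(c <- t) odd_count c < 24)%N].
Proof.
move=> ct ot rt; split; [| |move=> st].
- apply: (sum_bound (K := 1%N) _ _ ct ot rt) => c cc rc.
    by rewrite mul1n; case: (small_component_bounds cc rc).
  by move=> r4; rewrite mul1n; case: (odd_component_bounds cc r4 rc).
- apply: (sum_bound (K := 1%N) _ _ ct ot rt) => c cc rc.
    by rewrite mul1n; case: (small_component_bounds cc rc).
  by move=> r4; rewrite mul1n; case: (odd_component_bounds cc r4 rc).
have -> : (4 * \sum_(c <- t) even_count c + \sum_(c <- t) odd_count c =
    \sum_(c <- t) (4 * even_count c + odd_count c))%N.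
  by elim: (t) => [|c s IHs]; rewrite ?big_nil // !big_cons -IHs; lia.
have cst : all (predI viable_component short_component) t by rewrite all_predI ct.
apply: (sum_bound (K := 4%N) _ _ cst ot rt) => c /andP[cc sc] rc.
  by case: (small_component_bounds cc rc).
by move=> r4; case: (odd_component_bounds cc r4 rc) => r1 _ _ /(_ sc).
Qed.

(** * The two parts of a splint *)

Section Part.

Variables (E1 O1 E2 O2 : seq 'rV[rat]_4) (t : seq component).
Hypothesis splitE : splits_into (even_roots F) E1 E2.
Hypothesis splitO : splits_into (odd_roots F) O1 O2.
Let P1 := RootSys E1 O1.
Let P2 := RootSys E2 O2.

Lemma embeds_part_F4 D : embeds D P1 -> embeds D F.
Proof.
move=> DP; apply: embeds_trans DP _; exists id; split=> // a.
  exact: (splits_into_l splitE).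
exact: (splits_into_l splitO).
Qed.

(** An injective map of the 18 roots of F(4) into themselves is onto. *)
Lemma F4_not_embeds_part v : v \in E2 ++ O2 -> ~ embeds F P1.
Proof.
move=> vP2 [f fE].
have P1F : {subset pos_roots P1 <= pos_roots F}.
  move=> x; rewrite !mem_cat => /orP[/(splits_into_l splitE)->//|].
  by move=> /(splits_into_l splitO)->; rewrite orbT.
have vP1 : v \notin pos_roots P1.
  have [sE dE] := splitE; have [sO dO] := splitO.
  have vF : (v \in even_roots F) || (v \in odd_roots F).
    by rewrite sE sO !inE; move: vP2; rewrite mem_cat => /orP[] ->; rewrite !orbT.
  apply/negP; move: (dE v) (dO v) vP2; rewrite !mem_cat.
  have: (v \in E1) || (v \in E2) -> (v \in O1) || (v \in O2) -> False.
    by move=> vE vO; have := F4_even_odd (v := v); rewrite sE sO !inE vE vO => /(_ isT).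
  by do 4![case: (v \in _) => //=]; move=> /(_ isT isT).
(* The image of f has 18 elements and lies in the 18 roots of F(4). *)
have [|||_ E] := @uniq_min_size _ [seq f x | x <- pos_roots F] (pos_roots F).
- rewrite map_inj_in_uniq ?F4_uniq // => x y; case: fE => fi _ _ _; exact: fi.
- by move=> _ /mapP[x xF ->]; apply/P1F/(embedding_pos fE).
- by rewrite size_map.
have vF : v \in pos_roots F.
  move: vP2; rewrite !mem_cat => /orP[] vP2.
    by rewrite (splits_into_l (splits_into_sym splitE) vP2).
  by rewrite (splits_into_l (splits_into_sym splitO) vP2) orbT.
move: vF vP1; rewrite -E => /mapP[x xF ->]; by rewrite (embedding_pos fE).
Qed.

Hypothesis tP1 : embeds (positive_system_of t) P1.
Hypothesis t_wf : all wf_component t.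

Lemma part_admissible v : v \in E2 ++ O2 -> all admissible t.
Proof.
move=> vP2; apply: all_components t_wf tP1 => c wc cP1.
have := embeds_part_F4 cP1; case: c wc cP1 => //=.
- by move=> _ _ /cG2_not_embeds.
- by move=> m n n1 _ /(sB_not_embeds n1).
- move=> m n /andP[m2 _] _; have [//|n2] := leqP n 1.
  by move=> /(sD_not_embeds m2 n2).
- by move=> _ /(F4_not_embeds_part vP2).
- by move=> _ _ /sG3_not_embeds.
Qed.

Lemma part_short : has_chain 2 P2 -> all short_component t.
Proof.
move=> P2c; apply: all_components t_wf tP1 => c wc cP1.
have no4 : ~ has_chain 4 (positive_system c).
  by move/(embeds_chain cP1)/(chain4_excludes_chain2 splitE splitO).
have no3 : ~ has_pairs 3 (positive_system c).
  by move/(embeds_pairs cP1)/(pairs3_exclude_chain2 splitE splitO).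
clear cP1; case: c wc no4 no3 => //.
- move=> m n _ no4 _; apply/andP; split; rewrite leqNgt; apply/negP => m3; apply: no4.
    by apply: has_chain_le (sA_chain_l m n).
  by apply: has_chain_le (sA_chain_r m n).
- by move=> n n3 no4 _; case: no4; apply: sC_chain.
- move=> m n /andP[_ n1] _ no3; apply/eqP => m3; apply: no3.
  by rewrite m3; apply: sD_pairs.
Qed.

(** Stated contrapositively, since the existence of a chain is a proposition while
    [all_components] produces boolean properties. *)
Lemma part_chain2 : all viable_component t -> ~ has_chain 2 P1 ->
  ~~ has (fun c => 0 < odd_count c)%N t.
Proof.
move=> tc no2; rewrite -all_predC.
have t0 : all (fun c => viable_component c ==> (odd_count c == 0%N)) t.
  apply: all_components t_wf tP1 => c _ cP1; apply/implyP => cc; rewrite -leqn0 leqNgt.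
  by apply/negP => c0; apply: no2; apply: embeds_chain cP1 (component_chain2 cc c0).
have: all (predI viable_component
    (fun c => viable_component c ==> (odd_count c == 0%N))) t.
  by rewrite all_predI tc.
by apply: sub_all => c /andP[/= -> /eqP ->].
Qed.

End Part.

Lemma sum_eq0_all (f : component -> nat) t :
  all (fun c => f c == 0%N) t -> (\sum_(c <- t) f c = 0)%N.
Proof.
elim: t => [|c t IHt] /=; first by rewrite big_nil.
by move=> /andP[/eqP c0 /IHt t0]; rewrite big_cons c0 t0.
Qed.

Lemma A00_even_count t : all is_A00 t -> (\sum_(c <- t) even_count c = 0)%N.
Proof.
move=> t0; apply: sum_eq0_all; apply: sub_all t0 => c.
by case: c => // -[|m] // [|n] // _; rewrite even_count_sA.
Qed.

Lemma has_odd_count t : (0 < \sum_(c <- t) odd_count c)%N ->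
  has (fun c => 0 < odd_count c)%N t.
Proof.
apply: contraLR; rewrite -all_predC => t0; rewrite -leqNgt leqn0.
by apply/eqP/sum_eq0_all/(sub_all _ t0) => c /=; rewrite -leqNgt leqn0.
Qed.

Lemma part_nonempty t n (iota : 'rV_(rdim (positive_system_of t)) -> 'rV[rat]_n) :
  splint_type t -> exists v, v \in pos_roots (image_system iota).
Proof.
case: t iota => [|c t] iota // /and3P[_ /andP[wc _] _].
case E: (pos_roots (image_system iota)) => [|v s]; last by exists v; rewrite inE eqxx.
have := component_nonempty wc.
have: size (pos_roots (image_system iota)) = 0%N by rewrite E.
rewrite size_cat !size_map size_even_sum size_odd_sum !big_cons; lia.
Qed.

Lemma splint_type_cases t v E1 O1 E2 O2 :
    splits_into (even_roots F) E1 E2 -> splits_into (odd_roots F) O1 O2 ->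
    splint_type t -> (splint_rank t <= 4)%N ->
    embeds (positive_system_of t) (RootSys E1 O1) -> v \in E2 ++ O2 ->
  all is_A00 t \/ all viable_component t /\ (\sum_(c <- t) rank c <= 4)%N.
Proof.
move=> sE sO /and3P[_ wt /orP[->|]]; first by left.
rewrite -all_predC => t0 rt tP vP; right; split.
  by rewrite !all_predI wt t0 (part_admissible sE sO tP wt vP).
by move: rt; rewrite /splint_rank -big_filter (all_filterP t0).
Qed.

(** A type that is a sum of A(0,0) has no even root, so the other type has at
    least 10 and hence no odd root. Otherwise both types have odd roots, since
    neither has eight of them, and the chains of length two in each part force
    the other part to be short; then 4 e + o < 24 for both, a contradiction. *)
Lemma F4_split_types t1 t2 E1 O1 E2 O2 v1 v2 :
    splits_into (even_roots F) E1 E2 -> splits_into (odd_roots F) O1 O2 ->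
    splint_type t1 -> splint_type t2 ->
    (splint_rank t1 <= 4)%N -> (splint_rank t2 <= 4)%N ->
    embeds (positive_system_of t1) (RootSys E1 O1) ->
    embeds (positive_system_of t2) (RootSys E2 O2) ->
    (10 <= \sum_(c <- t1) even_count c + \sum_(c <- t2) even_count c)%N ->
    (8 <= \sum_(c <- t1) odd_count c + \sum_(c <- t2) odd_count c)%N ->
    v1 \in E1 ++ O1 -> v2 \in E2 ++ O2 ->
  (\sum_(c <- t1) odd_count c = 0 /\ \sum_(c <- t2) even_count c = 0)%N \/
  (\sum_(c <- t2) odd_count c = 0 /\ \sum_(c <- t1) even_count c = 0)%N.
Proof.
move=> sE sO tt1 tt2 r1 r2 tP1 tP2 e10 o8 vP1 vP2.
have [sE' sO'] := (splits_into_sym sE, splits_into_sym sO).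
have T1 := splint_type_cases sE sO tt1 r1 tP1 vP2.
have T2 := splint_type_cases sE' sO' tt2 r2 tP2 vP1.
have w1 : all wf_component t1 by case/and3P: tt1.
have w2 : all wf_component t2 by case/and3P: tt2.
case: T1 => [/A00_even_count e1|[c1 {}r1]]; case: T2 => [/A00_even_count e2|[c2 {}r2]].
- by lia.
- right; split=> //; apply/eqP; rewrite -leqn0 leqNgt; apply/negP => /has_odd_count o2.
  by have [] := odd_type_bounds c2 o2 r2; lia.
- left; split=> //; apply/eqP; rewrite -leqn0 leqNgt; apply/negP => /has_odd_count o1.
  by have [] := odd_type_bounds c1 o1 r1; lia.
have odd_lt8 t : all viable_component t -> (\sum_(c <- t) rank c <= 4)%N ->
    (\sum_(c <- t) odd_count c < 8)%N.
  move=> ct rt; have [->//|] := posnP (\sum_(c <- t) odd_count c)%N.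
  by move=> /has_odd_count ot; case: (odd_type_bounds ct ot rt).
have o1 : has (fun c => 0 < odd_count c)%N t1.
  by apply: has_odd_count; have := odd_lt8 _ c2 r2; lia.
have o2 : has (fun c => 0 < odd_count c)%N t2.
  by apply: has_odd_count; have := odd_lt8 _ c1 r1; lia.
exfalso; apply: (negP (part_chain2 tP1 w1 c1 _) o1) => P1c.
apply: (negP (part_chain2 tP2 w2 c2 _) o2) => P2c.
have s1 := part_short sE sO tP1 w1 P2c; have s2 := part_short sE' sO' tP2 w2 P1c.
have [_ _ /(_ s1)] := odd_type_bounds c1 o1 r1.
have [_ _ /(_ s2)] := odd_type_bounds c2 o2 r2.
lia.
Qed.

Lemma splits_into_nil (T : eqType) (s s1 s2 : seq T) : splits_into s s1 s2 ->
  s2 = [::] -> s1 =i s.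
Proof. by move=> [sE _] s20 x; rewrite sE inE s20 orbF. Qed.

Lemma F4_splint t1 t2 kappa1 kappa2 : @splint sF4 t1 t2 kappa1 kappa2 ->
  let P1 := image_system kappa1 in let P2 := image_system kappa2 in
  [/\ even_roots P1 =i even_roots F, odd_roots P1 = [::],
      even_roots P2 = [::] & odd_roots P2 =i odd_roots F] \/
  [/\ even_roots P2 =i even_roots F, odd_roots P2 = [::],
      even_roots P1 = [::] & odd_roots P1 =i odd_roots F].
Proof.
case=> /andP[tt1 tt2] [k1E k2E] kE dk /andP[r1 r2] P1 P2.
set E1 := even_roots P1; set O1 := odd_roots P1.
set E2 := even_roots P2; set O2 := odd_roots P2.
have E1F x : x \in E1 -> x \in even_roots F.
  by case/mapP=> y yD ->; apply: embedding_even k1E yD.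
have E2F x : x \in E2 -> x \in even_roots F.
  by case/mapP=> y yD ->; apply: embedding_even k2E yD.
have O1F x : x \in O1 -> x \in odd_roots F.
  by case/mapP=> y yD ->; apply: embedding_odd k1E yD.
have O2F x : x \in O2 -> x \in odd_roots F.
  by case/mapP=> y yD ->; apply: embedding_odd k2E yD.
have FEO x : x \in even_roots F -> x \in odd_roots F -> False.
  by move=> /F4_even_odd/negP.
have {}kE x : (x \in even_roots F) || (x \in odd_roots F) ->
    [\/ x \in E1, x \in O1, x \in E2 | x \in O2].
  rewrite -(@mem_pos_roots F) kE inE (@mem_pos_roots P1) (@mem_pos_roots P2) -orbA.
  by move/or4P.
have sE : splits_into (even_roots F) E1 E2.
  split=> x; last by apply: contra (dk x) => /andP[x1 x2]; rewrite !mem_cat x1 x2.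
  apply/idP/orP => [xF|[/E1F|/E2F] //].
  case: (kE x) => [|xP|xP|xP|xP]; rewrite ?xF //; first by left.
  - by case: (FEO x xF (O1F _ xP)).
  - by right.
  - by case: (FEO x xF (O2F _ xP)).
have sO : splits_into (odd_roots F) O1 O2.
  split=> x; last by apply: contra (dk x) => /andP[x1 x2]; rewrite !mem_cat x1 x2 !orbT.
  apply/idP/orP => [xF|[/O1F|/O2F] //].
  case: (kE x) => [|xP|xP|xP|xP]; rewrite ?xF ?orbT //; last by right.
  - by case: (FEO x (E1F _ xP) xF).
  - by left.
  - by case: (FEO x (E2F _ xP) xF).
have tP1 : embeds (positive_system_of t1) (RootSys E1 O1).
  exists kappa1; case: k1E => ki kD _ _; split=> // a; exact: map_f.
have tP2 : embeds (positive_system_of t2) (RootSys E2 O2).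
  exists kappa2; case: k2E => ki kD _ _; split=> // a; exact: map_f.
have [v1 v1P] := part_nonempty kappa1 tt1; have [v2 v2P] := part_nonempty kappa2 tt2.
have sE1 : size E1 = (\sum_(c <- t1) even_count c)%N by rewrite size_map size_even_sum.
have sO1 : size O1 = (\sum_(c <- t1) odd_count c)%N by rewrite size_map size_odd_sum.
have sE2 : size E2 = (\sum_(c <- t2) even_count c)%N by rewrite size_map size_even_sum.
have sO2 : size O2 = (\sum_(c <- t2) odd_count c)%N by rewrite size_map size_odd_sum.
have sizeE : (10 <= size E1 + size E2)%N.
  rewrite -size_cat -size_even_F4.
  by apply: uniq_leq_size F4_even_uniq _ => x; case: sE => -> _; rewrite mem_cat.
have sizeO : (8 <= size O1 + size O2)%N.
  rewrite -size_cat -size_odd_F4.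
  by apply: uniq_leq_size F4_odd_uniq _ => x; case: sO => -> _; rewrite mem_cat.
rewrite sE1 sE2 in sizeE; rewrite sO1 sO2 in sizeO.
have := F4_split_types sE sO tt1 tt2 r1 r2 tP1 tP2 sizeE sizeO v1P v2P.
rewrite -sE1 -sE2 -sO1 -sO2.
move=> [] [/size0nil z1 /size0nil z2]; [left|right]; split=> //.
- exact: splits_into_nil sE z2.
- exact: splits_into_nil (splits_into_sym sO) z1.
- exact: splits_into_nil (splits_into_sym sE) z2.
- exact: splits_into_nil sO z1.
Qed.

(** * The splint by parity *)

Lemma map_uniq_inj (T T' : eqType) (f : T -> T') (s : seq T) :
  uniq (map f s) -> {in s &, injective f}.
Proof.
elim: s => //= z s IHs /andP[zs us] x y; rewrite !inE.
case/predU1P=> [->|xs] /predU1P[->|ys] // fxy; last exact: IHs us x y xs ys fxy.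
  by rewrite fxy map_f in zs.
by rewrite -fxy map_f in zs.
Qed.

(** The positive root of A1 goes to delta, and the coordinates of B3 go to the three
    epsilon coordinates. The codomain is written with dimension 1 + 3 for the
    block operations on rows. *)
Definition A1B3_map (v : 'rV[rat]_(2 + (3 + 0))) : 'rV[rat]_(1 + 3) :=
  lsubmx v 0 ord0 *: eps ord0 + row_mx (0 : 'rV_1) (lsubmx (rsubmx v)).

Lemma A1B3_mapD : {morph A1B3_map : v w / v + w}.
Proof.
move=> v w; rewrite /A1B3_map !linearD /=.
rewrite [(lsubmx v + lsubmx w) 0 _]mxE scalerDl [RHS]addrACA.
by rewrite add_row_mx addr0.
Qed.

Lemma diffs_eps2 : diffs (@eps 2) = [:: eps ord0 - eps ord_max].
Proof.
rewrite /diffs.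
rewrite enum_ord_pairs !enum_ordSl /= !enum_ord0 /=.
by congr [:: _ - eps _]; apply/val_inj.
Qed.

Lemma A1B3_map_roots :
  map A1B3_map (even_roots (positive_system_of [:: cA 1; cB 3])) =
  even_roots F.
Proof.
rewrite [even_roots _]/= diffs_eps2 /= cats0 -!map_comp.
congr (_ :: _).
  rewrite /A1B3_map row_mxKl row_mxKr linear0 row_mx0 addr0 !mxE /=.
  by rewrite subr0 scale1r.
rewrite (eq_map (g := row_mx (0 : 'rV[rat]_1))) => [|w]; last first.
  by rewrite /A1B3_map /= row_mxKl row_mxKr row_mxKl mxE scale0r add0r.
have uE i : eps (rshift 1 i) = row_mx (0 : 'rV[rat]_1) (@eps 3 i).
  apply/rowP => j; rewrite !mxE; case: splitP => k jk; rewrite !mxE eqxx -val_eqE /= jk.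
    by rewrite ltn_eqF // ltn_addr.
  by rewrite eqn_add2l.
have rowB (v w : 'rV[rat]_3) :
    row_mx 0 (v - w) = row_mx 0 v - row_mx 0 w :> 'rV[rat]_(1 + 3).
  by rewrite opp_row_mx add_row_mx subr0.
have rowD (v w : 'rV[rat]_3) :
    row_mx 0 (v + w) = row_mx 0 v + row_mx 0 w :> 'rV[rat]_(1 + 3).
  by rewrite add_row_mx addr0.
have rowZ (v : 'rV[rat]_3) :
    row_mx 0 (1 *: v) = 1 *: row_mx 0 v :> 'rV[rat]_(1 + 3).
  by rewrite !scale1r.
rewrite !map_cat; congr (_ ++ (_ ++ _)); rewrite -map_comp; apply: eq_map => p /=.
- by rewrite !uE; apply: rowB.
- by rewrite !uE; apply: rowD.
- by rewrite !uE; apply: rowZ.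
Qed.

Lemma A1B3_embedding : @embedding (positive_system_of [:: cA 1; cB 3]) F A1B3_map.
Proof.
apply: additive_embedding.
- exact: A1B3_mapD.
- apply: map_uniq_inj; rewrite /pos_roots map_cat A1B3_map_roots /= cats0.
  exact: F4_even_uniq.
- by move=> v; rewrite A1B3_map_roots.
- by [].
Qed.

(** The i-th block carries the single root of the i-th copy of A(0,0), whose first
    coordinate is 1; this root goes to x i. *)
Fixpoint A00_map n (x : nat -> 'rV[rat]_4) :
    'rV[rat]_(rdim (positive_system_of (nseq n (sA 0 0)))) -> 'rV[rat]_4 :=
  match n return 'rV[rat]_(rdim (positive_system_of (nseq n (sA 0 0)))) -> _ with
  | 0 => fun=> 0
  | n'.+1 => fun v : 'rV_(2 + _) =>
      lsubmx v 0 ord0 *: x 0%N + A00_map (x \o S) (rsubmx v)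
  end.

Lemma A00_mapD n x : {morph @A00_map n x : v w / v + w}.
Proof.
elim: n x => [|n IHn] x v w /=; first by rewrite addr0.
by rewrite !linearD /= IHn [(lsubmx v + lsubmx w) 0 _]mxE scalerDl addrACA.
Qed.

Lemma A00_map0 n x : @A00_map n x 0 = 0.
Proof.
elim: n x => [|n IHn] x //=.
by rewrite !linear0 IHn mxE scale0r addr0.
Qed.

Lemma cross_diffs1 m (u v : 'I_1 -> 'rV[rat]_m) :
  cross_diffs u v = [:: u ord0 - v ord0].
Proof.
rewrite /cross_diffs.
by rewrite enum_ord_pairs !enum_ordSl /= !enum_ord0.
Qed.

Lemma A00_map_roots n x :
  map (@A00_map n x) (odd_roots (positive_system_of (nseq n (sA 0 0)))) = mkseq x n.
Proof.
elim: n x => [|n IHn] x //=.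
rewrite map_cat cross_diffs1 /= row_mxKl row_mxKr /mkseq /= (iotaDl 1 0) -!map_comp.
congr (_ :: _).
  by rewrite A00_map0 addr0 !mxE /= subr0 scale1r.
rewrite -/(mkseq (x \o S) n) -IHn; apply: eq_map => v /=.
by rewrite row_mxKl row_mxKr mxE scale0r add0r.
Qed.

Lemma A00_even_roots n : even_roots (positive_system_of (nseq n (sA 0 0))) = [::].
Proof.
have diffs1 m (u : 'I_1 -> 'rV[rat]_m) : diffs u = [::].
  by apply: size0nil; rewrite size_diffs.
by elim: n => //= n ->; rewrite !diffs1.
Qed.

Definition F4_odd (i : nat) : 'rV[rat]_4 := nth 0 (odd_roots F) i.

Lemma A00_map_F4 :
  map (@A00_map 8 F4_odd) (odd_roots (positive_system_of (nseq 8 (sA 0 0)))) =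
  odd_roots F.
Proof. by rewrite A00_map_roots -size_odd_F4 mkseq_nth. Qed.

Lemma A00_embedding :
  @embedding (positive_system_of (nseq 8 (sA 0 0))) F (@A00_map 8 F4_odd).
Proof.
apply: additive_embedding.
- exact: A00_mapD.
- apply: map_uniq_inj; rewrite /pos_roots map_cat A00_even_roots A00_map_F4.
  exact: F4_odd_uniq.
- by move=> v; rewrite A00_even_roots.
- by move=> v; rewrite A00_map_F4.
Qed.

(** The identity is the empty product of reflections. *)
Lemma ordered_equiv_id s1 s2 s1' s2' :
    s1.1 =i s1'.1 -> s1.2 =i s1'.2 -> s2.1 =i s2'.1 -> s2.2 =i s2'.2 ->
  ordered_equiv s1 s2 s1' s2'.
Proof.
have carries_id (s s' : seq 'rV_4) : s =i s' -> carries id s s'.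
  move=> ss' x; rewrite map_id !mem_cat ss'; congr (_ || _).
  by apply/mapP/mapP => -[y ys ->]; exists y; rewrite // ?ss' // -ss'.
by exists id; [exists [::] | split; apply: carries_id].
Qed.

Theorem mainTheorem6 :
  exists
    (iota1 : 'rV[rat]_(rdim (positive_system_of [:: cA 1; cB 3]))
               -> 'rV[rat]_(rdim (positive_system sF4)))
    (iota2 : 'rV[rat]_(rdim (positive_system_of (nseq 8 (sA 0 0))))
               -> 'rV[rat]_(rdim (positive_system sF4))),
    splint iota1 iota2 /\
    pos_roots (image_system iota1) =i even_roots (positive_system sF4) /\
    pos_roots (image_system iota2) =i odd_roots (positive_system sF4) /\
    (forall (t1 t2 : seq component)
       (kappa1 : 'rV[rat]_(rdim (positive_system_of t1))
                   -> 'rV[rat]_(rdim (positive_system sF4)))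
       (kappa2 : 'rV[rat]_(rdim (positive_system_of t2))
                   -> 'rV[rat]_(rdim (positive_system sF4))),
       splint kappa1 kappa2 ->
       splint_equiv (parts kappa1) (parts kappa2) (parts iota1) (parts iota2)).
Proof.
exists A1B3_map, (@A00_map 8 F4_odd).
set i1 : 'rV[rat]_(rdim (positive_system_of [:: cA 1; cB 3])) ->
  'rV[rat]_(rdim F) := A1B3_map.
set i2 : _ -> 'rV[rat]_(rdim F) := @A00_map 8 F4_odd.
have e1 : even_roots (image_system i1) = even_roots F by exact: A1B3_map_roots.
have o1 : odd_roots (image_system i1) = [::] by [].
have e2 : even_roots (image_system i2) = [::].
  by apply: (congr1 (map i2)) (A00_even_roots 8).
have o2 : odd_roots (image_system i2) = odd_roots F by exact: A00_map_F4.
have p1 : pos_roots (image_system i1) =i even_roots F.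
  by move=> v; rewrite mem_pos_roots e1 o1 orbF.
have p2 : pos_roots (image_system i2) =i odd_roots F.
  by move=> v; rewrite mem_pos_roots e2 o2.
split; last split=> //; last split=> //.
- split.
  + by [].
  + by split; [exact: A1B3_embedding | exact: A00_embedding].
  + by move=> v; rewrite mem_pos_roots -p1 -p2.
  + move=> v; apply/negP => /andP[v1 v2]; have := F4_even_odd (v := v).
    by rewrite -(p1 v) -(p2 v) v1 v2 => /(_ isT).
  + by rewrite /splint_rank !big_cons !big_nil.
move=> t1 t2 kappa1 kappa2 /F4_splint[] [ek ok ek' ok']; [left | right].
- apply: ordered_equiv_id => v; rewrite /parts /fst /snd.
  + by rewrite ek e1.
  + by rewrite ok o1.
  + by rewrite ek' e2.
  + by rewrite ok' o2.
- apply: ordered_equiv_id => v; rewrite /parts /fst /snd.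
  + by rewrite ek' e2.
  + by rewrite ok' o2.
  + by rewrite ek e1.
  + by rewrite ok o1.
Qed.
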